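(* Let $b\ge4$ be an even base and $B=b-1$, and let $n$ be a positive integer. Consider Kaprekar indices $\mathbf k=(k_0,\ldots,k_B)$ of digit-count $n=\sum_i k_i$ with $k_1=k_2=\cdots=k_{B-1}\ge1$. Let $N_S$ be the number of those with $1\le k_0=k_B$ (symmetric fixed points) and $N_A$ the number of those with $1\le k_0<k_B<k_0+k_1$ (almost-symmetric fixed points). Then $$N_S=\left\lfloor\frac{n-2}{b-2}\right\rfloor\ \text{ for even } n,\qquad N_S=0\ \text{ for odd } n,$$ $$N_A=\sum_{m=1}^{\lfloor(n-1)/(2(b-1))\rfloor}\left\lfloor\frac{n-2(b-1)m+b-3}{b-2}\right\rfloor\ \text{ for odd } n,$$ $$N_A=\sum_{m=1}^{\lfloor(n-b)/(2(b-1))\rfloor}\left\lfloor\frac{n-2(b-1)m-2}{b-2}\right\rfloor\ \text{ for even } n.$$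
   Context: The Kaprekar index of an integer written with $n$ base-$b$ digits is the $b$-tuple $(k_0,\ldots,k_B)$ of nonnegative integers, where $k_i$ is the number of occurrences of the digit $i$; the digit-count is $n=\sum_i k_i$. Sums whose upper limit is less than the lower limit are empty (equal to $0$). *)

(* Defs.v *)
From mathcomp Require Import all_boot.
From mathcomp Require Export finmap.

Set Implicit Arguments.
Unset Strict Implicit.
Unset Printing Implicit Defensive.

Local Open Scope nat_scope.
Local Open Scope fset_scope.

(* The n base-b digits of x < b ^ n, least significant first; leading zeros   *)
(* count as digits.                                                           *)
Definition digits (b n x : nat) : seq nat :=
  mkseq (fun j => x %/ b ^ j %% b) n.

Definition kaprekar_index (b n x : nat) : b.-tuple nat :=
  [tuple count_mem (val i) (digits b n x) | i < b].

Definition digit_count (b : nat) (k : b.-tuple nat) : nat :=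
  \sum_(i < b) tnth k i.

Definition kaprekar_indices (b n : nat) : {fset b.-tuple nat} :=
  [fset kaprekar_index b n (val x) | x in 'I_(b ^ n)].

(* k_i; only used for i < b. *)
Definition mult (b : nat) (k : b.-tuple nat) (i : nat) : nat := nth 0 k i.

(* k_1 = k_2 = ... = k_(B-1) >= 1, where B = b - 1. *)
Definition flat_middle (b : nat) (k : b.-tuple nat) : bool :=
  [forall i : 'I_b, (1 <= i <= b - 2) ==> (mult k i == mult k 1)]
  && (1 <= mult k 1).

(* In the next two sets the condition digit_count k == n is automatic.        *)
Definition symmetric_indices (b n : nat) : {fset b.-tuple nat} :=
  [fset k in kaprekar_indices b n |
     [&& digit_count k == n, flat_middle k,
         1 <= mult k 0 & mult k 0 == mult k (b - 1)]].

Definition almost_symmetric_indices (b n : nat) : {fset b.-tuple nat} :=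
  [fset k in kaprekar_indices b n |
     [&& digit_count k == n, flat_middle k,
         1 <= mult k 0, mult k 0 < mult k (b - 1)
       & mult k (b - 1) < mult k 0 + mult k 1]].

Definition N_S (b n : nat) : nat := #|` symmetric_indices b n|.

Definition N_A (b n : nat) : nat := #|` almost_symmetric_indices b n|.

(* Main.v *)
Require Import Defs.
From mathcomp Require Import all_boot.
From mathcomp Require Import zify.

Local Open Scope nat_scope.

(** A list of [n] digits is the digit list of some [x < b ^ n], so every
    [b]-tuple of sum [n] is a Kaprekar index of digit-count [n].  The indices
    to be counted are therefore the tuples (a, c, ..., c, a + d) with
    2 a + d + (b - 2) c = n, where d = 0 or 1 <= d < c.  As b is even, d has the
    parity of n.  For d >= 1, writing d = 2 m - (n mod 2) and c = d + e, the entry a is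
    determined by (m, e), and the condition a >= 1 becomes
    (b - 1) d + (b - 2) e + 2 <= n, which bounds e for each m. *)

(** Horner's rule: prepending the digit [d] replaces [x] by [x * b + d], whose higher digits are
    those of [x]. *)
Lemma digits_surj (b : nat) (s : seq nat) :
  0 < b -> all (gtn b) s ->
  exists2 x, x < b ^ size s & digits b (size s) x = s.
Proof.
move=> b0; elim: s => [|d s IHs] /=; first by exists 0.
case/andP=> db /IHs [x xlt xs]; exists (x * b + d).
  by rewrite expnSr; nia.
rewrite /digits /mkseq /= expn0 divn1 modnMDl modn_small // (iotaDl 1 0).
rewrite -map_comp; congr (_ :: _); rewrite -[RHS]xs; apply: eq_map => j /=.
by rewrite expnS divnMA divnMDl // (divn_small db) addn0.
Qed.

Lemma mem_kaprekar_indices (b n : nat) (k : b.-tuple nat) :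
  0 < b -> digit_count k = n -> k \in kaprekar_indices b n.
Proof.
move=> b0 kn.
(* Only multiplicities matter, so the digits may come in blocks, [tnth k i] copies of each [i]. *)
pose s := flatten [seq nseq (tnth k i) (val i) | i <- enum 'I_b].
have sn : size s = n.
  rewrite size_flatten /shape -map_comp sumnE big_map big_enum /= -kn.
  by apply: eq_bigr => i _; rewrite size_nseq.
have sb : all (gtn b) s.
  apply/allP => x /flatten_mapP [i _]; rewrite mem_nseq => /andP [_ /eqP ->].
  exact: ltn_ord.
have [x] := digits_surj b s b0 sb; rewrite sn => xlt xs.
apply/imfsetP; exists (Ordinal xlt) => //=; apply: eq_from_tnth => i.
rewrite tnth_mktuple xs count_flatten -map_comp sumnE big_map big_enum /=.
rewrite (bigD1 i) //= count_nseq /= eqxx mul1n big1 ?addn0 // => j ji.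
by rewrite count_nseq /= (_ : (val j == val i) = false) //; apply: negbTE.
Qed.

Definition flat_index (b a c z : nat) : b.-tuple nat :=
  [tuple if val i == 0 then a else if val i == b - 1 then z else c | i < b].

Lemma mult_tnth (b : nat) (k : b.-tuple nat) (i : 'I_b) :
  mult k i = tnth k i.
Proof. by rewrite /mult (tnth_nth 0). Qed.

Lemma mult_flat_index (b a c z i : nat) : i < b ->
  mult (flat_index b a c z) i =
    if i == 0 then a else if i == b - 1 then z else c.
Proof. by move=> ib; rewrite -[i]/(val (Ordinal ib)) mult_tnth tnth_mktuple. Qed.

(** For [2 < b] the positions 0, 1 and [b - 1] are distinct, so all three parameters can be read
    off. *)
Lemma mult_flat_index01B (b a c z : nat) : 2 < b ->
  let k := flat_index b a c z in
  [/\ mult k 0 = a, mult k 1 = c & mult k (b - 1) = z].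
Proof.
move=> b2; have b1 : (1 == b - 1) = false by lia.
have b0 : (b - 1 == 0) = false by lia.
by split; rewrite mult_flat_index ?b0 ?b1 ?eqxx /=; lia.
Qed.

Lemma flat_index_inj (b a c z a' c' z' : nat) : 2 < b ->
  flat_index b a c z = flat_index b a' c' z' -> [/\ a = a', c = c' & z = z'].
Proof.
move=> b2 E; have [] := mult_flat_index01B b a c z b2.
by rewrite E; have [-> -> ->] := mult_flat_index01B b a' c' z' b2.
Qed.

Lemma digit_count_flat_index (b a c z : nat) : 1 < b ->
  digit_count (flat_index b a c z) = a + (b - 2) * c + z.
Proof.
case: b => [|[|b]] // _; rewrite /digit_count big_ord_recl big_ord_recr /=.
rewrite !tnth_mktuple /= subn1 eqxx subn2 /= addnA; congr (_ + _ + _).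
rewrite (eq_bigr (fun=> c)) ?sum_nat_const ?card_ord // => i _.
rewrite tnth_mktuple /=; case: ifP; rewrite /bump /=; have := ltn_ord i; lia.
Qed.

Lemma flat_middle_flat_index (b a c z : nat) : 2 < b ->
  flat_middle (flat_index b a c z) = (0 < c).
Proof.
move=> b2; rewrite /flat_middle.
have mid i : 1 <= i <= b - 2 -> mult (flat_index b a c z) i = c.
  move=> ib; rewrite mult_flat_index; last lia.
  by case: ifP; try lia; case: ifP; lia.
rewrite mid; last lia; rewrite (introT forallP) // => i.
by apply/implyP => /mid ->.
Qed.

Lemma flat_middleE (b : nat) (k : b.-tuple nat) :
  flat_middle k -> k = flat_index b (mult k 0) (mult k 1) (mult k (b - 1)).
Proof.
case/andP=> /forallP mid _; apply: eq_from_tnth => i.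
rewrite tnth_mktuple -mult_tnth.
case: eqP => [-> //|i0]; case: eqP => [-> //|iB].
by apply/eqP; apply: (implyP (mid i)); move: i0 iB (ltn_ord i) => /=; lia.
Qed.

Lemma card_fset_uniq (K : choiceType) (A : {fset K}) (s : seq K) :
  uniq s -> A =i s -> #|` A|%fset = size s.
Proof.
by move=> us As; apply/perm_size/uniq_perm.
Qed.

(** The digit-count would be 2 k_0 + (b - 2) k_1, which is even because [b] is. *)
Lemma N_S_odd (b n : nat) : 4 <= b -> ~~ odd b -> odd n -> N_S b n = 0.
Proof.
move=> hb bev nodd; rewrite /N_S (card_fset_uniq _ _ [::]) // => k.
rewrite /symmetric_indices !finmap.inE.
apply/negP => /and5P [_ /eqP kn /flat_middleE kE _ /eqP k0].
have : ~~ odd ((b - 2) * mult k 1) by rewrite oddM oddB; lia.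
by move: kn; rewrite kE digit_count_flat_index -?kE -?k0; lia.
Qed.

Lemma N_S_even (b n : nat) : 4 <= b -> ~~ odd b -> ~~ odd n -> 0 < n ->
  N_S b n = (n - 2) %/ (b - 2).
Proof.
move=> hb bev nev n0.
(* The outer entries forced by the middle entry [c], from 2 a + (b - 2) c = n. *)
pose a c := (n - (b - 2) * c)./2.
rewrite /N_S (card_fset_uniq _ _
  [seq flat_index b (a c) c (a c) | c <- iota 1 ((n - 2) %/ (b - 2))]).
- by rewrite size_map size_iota.
- rewrite map_inj_uniq ?iota_uniq // => c c' /flat_index_inj [] //; lia.
(* The range of [c] expresses exactly that [a c] is at least 1. *)
have cP c : (c \in iota 1 ((n - 2) %/ (b - 2))) =
            (0 < c) && ((b - 2) * c + 2 <= n).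
  by rewrite mem_iota add1n ltnS leq_divRL; lia.
have evM c : ~~ odd ((b - 2) * c) by rewrite oddM oddB; lia.
move=> k; rewrite /symmetric_indices !finmap.inE; apply/idP/mapP.
  case/and5P=> _ /eqP kn kf k0 /eqP kB.
  move: kn (kf); rewrite (flat_middleE _ _ kf) digit_count_flat_index; last lia.
  rewrite flat_middle_flat_index -?kB; last lia.
  set x := mult k 0 in k0 *; set c := mult k 1 => kn c0.
  exists c; first by rewrite cP; lia.
  by rewrite (_ : a c = x) // /a; lia.
case=> c; rewrite cP => /andP [c0 cn] ->.
have kn : digit_count (flat_index b (a c) c (a c)) = n.
  by rewrite digit_count_flat_index /a; have := evM c; lia.
rewrite mem_kaprekar_indices ?kn ?eqxx ?flat_middle_flat_index; try lia.
have [|-> _ ->] := mult_flat_index01B b (a c) c (a c); first lia.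
by rewrite c0 eqxx /a; lia.
Qed.

(** Treats both parities of [n] at once: the hypothesis says that [M] and [F] delimit exactly the
    pairs (m, e) with a >= 1, so [F m] counts the admissible e for each m. *)
Lemma N_A_sum (b n M : nat) (F : nat -> nat) :
  4 <= b -> ~~ odd b ->
  (forall m e, 0 < m -> 0 < e ->
    (m <= M) && (e <= F m) =
    ((b - 1) * (2 * m - odd n) + (b - 2) * e + 2 <= n)) ->
  N_A b n = \sum_(1 <= m < M.+1) F m.
Proof.
move=> hb bev MF.
pose d m := 2 * m - odd n.
(* Solves 2 a + d + (b - 2) (d + e) = n for a. *)
pose a m e := (n - (b - 1) * d m - (b - 2) * e)./2.
pose K m e := flat_index b (a m e) (d m + e) (a m e + d m).
have evM x : ~~ odd ((b - 2) * x) by rewrite oddM oddB; lia.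
have bM x : (b - 1) * x = (b - 2) * x + x by nia.
rewrite /N_A (card_fset_uniq _ _ [seq K m e | m <- iota 1 M, e <- iota 1 (F m)]).
- rewrite size_allpairs_dep sumnE big_map /index_iota subn1.
  by apply: eq_bigr => m _; rewrite size_iota.
- apply: allpairs_uniq_dep; rewrite ?iota_uniq //.
    by move=> m _; apply: iota_uniq.
  move=> [m e] [m' e'] /allpairsPdep [x [y [xM _ [-> ->]]]].
  case/allpairsPdep=> [x' [y' [x'M _ [-> ->]]]] /=.
  have b2 : 2 < b by lia.
  (* The last entry minus the first gives [d], hence m; the middle entry then gives e. *)
  move=> /(flat_index_inj _ _ _ _ _ _ _ b2) [ea ec ez].
  move: xM x'M; rewrite !mem_iota /d in ec ez * => xM x'M.
  have -> : x = x' by lia.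
  by have -> : y = y' by lia.
move=> k; rewrite /almost_symmetric_indices !finmap.inE; apply/idP/allpairsPdep.
  case/and4P=> _ /eqP kn kf /and3P [k0 kB kc].
  move: kn (kf); rewrite (flat_middleE _ _ kf) digit_count_flat_index; last lia.
  rewrite flat_middle_flat_index; last lia.
  move: (mult k 0) (mult k 1) (mult k (b - 1)) k0 kB kc => x c z x0 xz zc kn c0.
  (* Modulo 2 the term [(b - 2) * c] vanishes, leaving n = x + z. *)
  have oz : odd (z - x) = odd n.
    by rewrite -kn oddB ?oddD ?(negbTE (evM c)) ?addbF 1?addbC //; lia.
  have [m m0 dm] : exists2 m, 0 < m & d m = z - x.
    by exists (z - x + odd n)./2; rewrite /d -oz; lia.
  have [e e0 cE] : exists2 e, 0 < e & c = d m + e.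
    by exists (c - d m); rewrite dm; lia.
  have bc : (b - 2) * c = (b - 2) * d m + (b - 2) * e by rewrite cE mulnDr.
  have := MF m e m0 e0; rewrite -/(d m) bM => mP.
  have /andP [mM eF] : (m <= M) && (e <= F m) by rewrite mP; lia.
  exists m, e; split; rewrite ?mem_iota; try lia.
  have xE : a m e = x.
    rewrite /a bM -kn bc; move: ((b - 2) * d m) ((b - 2) * e) => u v; lia.
  by rewrite /K xE -cE dm; congr flat_index; lia.
case=> m [e [mM eF ->]].
have [m0 e0] : 0 < m /\ 0 < e by move: mM eF; rewrite !mem_iota; lia.
have := MF m e m0 e0; rewrite -/(d m) => mP.
have {mP} mP : (b - 1) * d m + (b - 2) * e + 2 <= n.
  by rewrite -mP; move: mM eF; rewrite !mem_iota; lia.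
(* Here m >= 1 matters: for odd [n], [d 0] truncates to 0. Equal parity makes the halving in [a]
   exact. *)
have dodd : odd (d m) = odd n by rewrite /d; lia.
have a0 : 0 < a m e by rewrite /a; lia.
have kn : digit_count (K m e) = n.
  rewrite digit_count_flat_index ?mulnDr; last lia.
  move: mP (evM (d m)) (evM e) dodd; rewrite /a !bM {MF evM bM}.
  by move: ((b - 2) * d m) ((b - 2) * e) (d m) => u v w; lia.
rewrite mem_kaprekar_indices ?kn ?eqxx ?flat_middle_flat_index; try lia.
have [|-> -> ->] := mult_flat_index01B b (a m e) (d m + e) (a m e + d m).
  lia.
by move: m0 a0; rewrite /d; lia.
Qed.

(* Truncated subtraction is harmless: every difference below is nonnegative   *)
(* for the relevant n and m, except n - b for even n < b, where the sum is    *)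
(* empty both with truncation and in the integers.                            *)
Theorem mainTheorem4 (b n : nat) (hb : 4 <= b) (hb_even : ~~ odd b)
    (hn : 0 < n) :
  (~~ odd n -> N_S b n = (n - 2) %/ (b - 2)) /\
  (odd n -> N_S b n = 0) /\
  (odd n ->
     N_A b n = \sum_(1 <= m < ((n - 1) %/ (2 * (b - 1))).+1)
                  (n - 2 * (b - 1) * m + b - 3) %/ (b - 2)) /\
  (~~ odd n ->
     N_A b n = \sum_(1 <= m < ((n - b) %/ (2 * (b - 1))).+1)
                  (n - 2 * (b - 1) * m - 2) %/ (b - 2)).
Proof.
split; first by move=> nev; apply: N_S_even.
split; first by apply: N_S_odd.
(* An m contributes iff e = 1 is admissible. For e = 1 the condition reads 2 (b - 1) m + 1 <= n for
   odd [n] and 2 (b - 1) m + b <= n for even [n], whence the two upper limits. *)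
split=> [nodd|nev]; apply: N_A_sum => // m e m0 e0.
- rewrite nodd !leq_divRL; try lia.
  have -> : (b - 1) * (2 * m - 1) = 2 * (b - 1) * m - (b - 1) by nia.
  rewrite (mulnC m) (mulnC e).
  have : b - 2 <= (b - 2) * e by rewrite leq_pmulr.
  have : 2 * (b - 1) <= 2 * (b - 1) * m by rewrite leq_pmulr.
  have : ~~ odd (2 * (b - 1) * m) by rewrite -mulnA mul2n odd_double.
  by set p := 2 * (b - 1) * m; set q := (b - 2) * e; lia.
- rewrite (negbTE nev) subn0 !leq_divRL; try lia.
  have -> : (b - 1) * (2 * m) = 2 * (b - 1) * m by nia.
  rewrite (mulnC m) (mulnC e).
  have : b - 2 <= (b - 2) * e by rewrite leq_pmulr.
  have : 2 * (b - 1) <= 2 * (b - 1) * m by rewrite leq_pmulr.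
  by set p := 2 * (b - 1) * m; set q := (b - 2) * e; lia.
Qed.
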